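(* Let $X$ be a topological space and $Y$ a Hausdorff topological space, and let $f\in\mathcal{M}(X,Y)$. a) A net $(f_\nu)_{\nu\in I}$ in $\mathcal{M}(X,Y)$ converges to $f$ if and only if there are some $\nu_0\in I$ and usco maps $g_\nu:X\to Y$, $\nu\ge\nu_0$, such that (i) $f_\nu\subset g_\nu$ for $\nu\ge\nu_0$; (ii) $g_\nu\subset g_{\nu'}$ for $\nu\ge\nu'\ge\nu_0$; (iii) $f$ is the unique minimal usco map contained in $\bigcap_{\nu\ge\nu_0}g_\nu$. b) A sequence $(f_n)_{n\in\mathbb{N}}$ in $\mathcal{M}(X,Y)$ converges to $f$ if and only if there exists a sequence of usco maps $(g_n)_{n\in\mathbb{N}}$ from $X$ to $Y$ such that (i) $f_n\subset g_n$ for $n\in\mathbb{N}$; (ii) $g_m\subset g_n$ for each $m\ge n$; (iii) $f$ is the unique minimal usco map contained in $\bigcap_{n\in\mathbb{N}}g_n$.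
   Context: A set-valued map $g:X\to Y$ is usco if $g(x)$ is a nonempty compact subset of $Y$ for each $x\in X$ and $\{x\in X: g(x)\subset U\}$ is open in $X$ for each open $U\subset Y$. Set-valued maps are identified with their graphs, so inclusions and intersections are understood pointwise. A usco map $g$ is minimal if $h=g$ for every usco $h:X\to Y$ with $h\subset g$. $\mathcal{M}(X,Y)$ is the set of all minimal usco maps from $X$ to $Y$. For a usco map $g:X\to Y$, $[g]=\{f\in\mathcal{M}(X,Y): f\subset g\}$. A filter $\mathcal{F}$ on $\mathcal{M}(X,Y)$ converges to $f\in\mathcal{M}(X,Y)$ if $\{f\}=\bigcap\{[g]: g:X\to Y \text{ usco},\ [g]\in\mathcal{F}\}$ (in particular at least one usco $g$ with $[g]\in\mathcal{F}$ is required to exist). A net $(f_\nu)_{\nu\in I}$ indexed by a directed set $I$ converges to $f$ if the filter generated by $\{\{f_\nu:\nu\ge\nu_0\}:\nu_0\in I\}$ converges to $f$; a sequence $(f_n)$ converges to $f$ if its Fréchet filter, generated by $\{\{f_m:m\ge n\}:n\in\mathbb{N}\}$, converges to $f$. *)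

(* Defs.v *)
From HB Require Import structures.
From mathcomp Require Import all_boot all_order.
From mathcomp Require Import all_classical.
From mathcomp Require Import topology.

Set Implicit Arguments.
Unset Strict Implicit.
Unset Printing Implicit Defensive.

Local Open Scope classical_set_scope.

Section Usco.
Context {X Y : topologicalType}.
Implicit Types g h : X -> set Y.

(* A set-valued map is a function [X -> set Y]; inclusion of graphs is
   pointwise inclusion. *)
Definition map_sub g h := forall x, g x `<=` h x.

Definition usco g :=
  [/\ forall x, g x !=set0,
      forall x, compact (g x)
    & forall U : set Y, open U -> open [set x | g x `<=` U]].

Definition minimal_usco g :=
  usco g /\ forall h, usco h -> map_sub h g -> h = g.

End Usco.

Record minusco (X Y : topologicalType) := Minusco {
  minusco_map :> X -> set Y;
  minuscoP : minimal_usco minusco_map }.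

(* Equality in [minusco X Y] is equality of set-valued maps. *)
Lemma minusco_inj (X Y : topologicalType) : injective (@minusco_map X Y).
Proof.
move=> [f fP] [g gP] /= fg; move: fP gP; rewrite fg => fP gP.
by congr Minusco; exact: Prop_irrelevance.
Qed.

Section Convergence.
Context {X Y : topologicalType}.

(* The set [g] of the minimal usco maps contained in g. *)
Definition minusco_in (g : X -> set Y) : set (minusco X Y) :=
  [set f | map_sub f g].

(* The first clause is needed because an intersection over an empty family is
   the full set in [classical_sets]. *)
Definition converges_to (F : set_system (minusco X Y)) (f : minusco X Y) :=
  (exists2 g : X -> set Y, usco g & F (minusco_in g)) /\
  [set f] =
    \bigcap_(g in [set g : X -> set Y | usco g /\ F (minusco_in g)])
      minusco_in g.

Definition unique_minusco_in (f : minusco X Y) (g : X -> set Y) :=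
  map_sub f g /\ forall h : minusco X Y, map_sub h g -> h = f.

End Convergence.

Definition directed d (I : preorderType d) :=
  (exists i : I, True) /\
  forall i j : I, exists k : I, (i <= k)%O /\ (j <= k)%O.

(* The tails of a net form a filter base, so the filter they generate consists
   of their supersets. On [nat] this is the filter of a sequence. *)
Definition tail_filter d (I : preorderType d) T (u : I -> T) : set_system T :=
  filter_from setT (fun i : I => u @` [set j | (i <= j)%O]).

Lemma tail_filter_proper d (I : preorderType d) T (u : I -> T) :
  directed I -> ProperFilter (tail_filter u).
Proof.
move=> [[i0 _] dirI]; apply: filter_from_proper; last first.
  by move=> i _; exists (u i), i => //=; exact: Order.PreorderTheory.lexx.
apply: filter_fromT_filter; first by exists i0.
move=> i j; have [k [ik jk]] := dirI i j; exists k => _ [l /= kl <-].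
by split; exists l => //=; exact: Order.PreorderTheory.le_trans kl.
Qed.

(* Main.v *)
Require Import Defs.
From mathcomp Require Import all_boot all_order.
From mathcomp Require Import all_classical.
From mathcomp Require Import topology.

Set Implicit Arguments.
Unset Strict Implicit.
Unset Printing Implicit Defensive.

Local Open Scope classical_set_scope.

(* Intersections of usco maps into a Hausdorff space are usco as soon as they
   have nonempty values.  If the net converges, take for [g_i] the intersection
   of all the usco maps containing every [u_j] with [j >= i]; its values are
   nonempty because it contains [u_i].  Conversely, if [u_j] is contained in
   [h] for all [j >= i1], then the maps [x |-> h x `&` g_j x], which contain [u_j],
   decrease, so by compactness their intersection is usco and, by Zorn's
   lemma, contains a minimal usco map; this map can only be [f], whence
   [f] is contained in [h]. *)

(** * Covering compact sets by interiors of sets from an ideal *)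

(* Stands in for [compact_cover], which requires a pointed space. *)
Lemma compact_ideal_cover (T : topologicalType) (K : set T)
    (J : set (set T)) :
  compact K -> J set0 ->
  (forall A B, J A -> J B -> J (A `|` B)) ->
  (forall y, K y -> exists2 V, nbhs y V & J V) ->
  exists2 A, J A & K `<=` A°.
Proof.
move=> /compact_near_coveringP cK J0 JU cover.
(* [J] is directed under inclusion, so eventually along [F] a set contains any given member of [J].
   Near-covering compactness then turns local covers into one set [A] with [K] inside the interior
   of every superset of [A]. *)
pose F := filter_from J (fun A => [set B : set T | A `<=` B]).
have FF : Filter F.
  apply: filter_from_filter; first by exists set0.
  move=> A B JA JB; exists (A `|` B); first exact: JU.
  by move=> C /= ABC; split=> z ?; apply: ABC; [left|right].
have [|A JA /= AP] := cK (set T) F (fun B y => B° y) FF.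
  move=> y /cover[V yV JV]; exists (V°, [set B | V `<=` B]) => /=.
    by split; [exact: nbhs_interior|exists V].
  by move=> [z B] /= [zV VB]; exact: interiorS zV.
by exists A => //; exact: AP.
Qed.

(** The sets whose complement is a neighbourhood of [y] form an ideal, and by the Hausdorff property
    every point of [K] has a neighbourhood in it. *)
Lemma compact_separate_point (T : topologicalType) (K : set T) (y : T) :
  hausdorff_space T -> compact K -> ~ K y ->
  exists2 A, nbhs y (~` A) & K `<=` A°.
Proof.
move=> hT cK nKy.
apply: (compact_ideal_cover (J := [set A | nbhs y (~` A)])) => //=.
- by rewrite setC0; exact: filterT.
- by move=> A B yA yB; rewrite setCU; exact: filterI.
- move=> z Kz; have zy : z != y by apply/eqP => zy; apply: nKy; rewrite -zy.
  move: hT; rewrite open_hausdorff => /(_ _ _ zy)[[A B] /= [zA yB]].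
  move=> [oA oB /eqP AB0]; rewrite !inE in zA yB.
  exists A; first exact: open_nbhs_nbhs.
  apply: (filterS _ (open_nbhs_nbhs (conj oB yB))) => t Bt At.
  by have : (A `&` B) t by []; rewrite AB0.
Qed.

(** * Intersections of usco maps and existence of minimal ones *)

Section UscoTheory.
Context {X Y : topologicalType}.
Implicit Types g h : X -> set Y.

Lemma usco_near g x (U : set Y) :
  usco g -> open U -> g x `<=` U -> \forall x' \near x, g x' `<=` U.
Proof.
by move=> [_ _ gU] oU gxU; apply: open_nbhs_nbhs; split=> //; exact: gU.
Qed.

(** For upper semicontinuity at [x], the part of [g i0 x] outside [U] is covered by the interior of
    a set [A] that the intersection avoids near [x]. The inclusion of [g i0] in the union of [U] and
    this interior persists near [x], and there the intersection lies in [U]. *)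
Lemma usco_bigcap (I : Type) (D : set I) (g : I -> X -> set Y) :
  hausdorff_space Y -> D !=set0 -> (forall i, D i -> usco (g i)) ->
  (forall x, (\bigcap_(i in D) g i x) !=set0) ->
  usco (fun x => \bigcap_(i in D) g i x).
Proof.
move=> hY [i0 Di0] gD ne; split => //.
  move=> x; have [_ cg _] := gD _ Di0; apply: subclosed_compact (cg x) _.
    apply: closed_bigI => i Di; have [_ ci _] := gD _ Di.
    exact: compact_closed.
  exact: bigcap_inf.
move=> U oU; rewrite openE => x /= gxU; rewrite /interior.
have [_ /(_ x) cg _] := gD _ Di0.
have [||||A JA KA] := @compact_ideal_cover _ (g i0 x `&` ~` U)
  [set A | \forall x' \near x, forall z, A z -> ~ (\bigcap_(i in D) g i x') z].
- by apply: compact_closedI => //; exact: open_closedC.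
- by apply: nearW.
- by move=> A B /= JA JB; near=> x' => z [Az|Bz];
    [have := near JA x'; apply|have := near JB x'; apply].
- move=> y [_ nUy].
  have [i Di ngi] : exists2 i, D i & ~ g i x y.
    apply: contrapT => H; apply/nUy/gxU => i Di.
    by apply: contrapT => ?; apply: H; exists i.
  have [_ /(_ x) ci _] := gD _ Di.
  have [A yA giA] := compact_separate_point hY ci ngi.
  (* Near [x] the values of [g i] stay in the interior of [A], so they miss this neighbourhood of
     [y]. *)
  exists (~` A) => //=.
  have := usco_near (gD _ Di) (@open_interior _ A) giA.
  apply: filterS => x' gA z nAz gz; apply: nAz; apply: interior_subset.
  exact/gA/gz.
have UA : g i0 x `<=` U `|` A°.
  by move=> y gy; have [Uy|nUy] := pselect (U y); [left|right; exact: KA].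
have near1 := usco_near (gD _ Di0) (openU oU (@open_interior _ A)) UA.
apply: filterS2 near1 JA => x' gU nA z gz.
have [//|/interior_subset Az] := gU _ (gz _ Di0).
by case: (nA _ Az gz).
Unshelve. all: by end_near. Qed.

(** The values at [x] are a base of a proper filter; a cluster point of it in the compact set
    [g i0 x] lies in every [g i x], as these are closed. *)
Lemma usco_bigcap_filtered (I : Type) (D : set I) (g : I -> X -> set Y) :
  hausdorff_space Y -> D !=set0 -> (forall i, D i -> usco (g i)) ->
  (forall i j, D i -> D j ->
    exists k, [/\ D k, map_sub (g k) (g i) & map_sub (g k) (g j)]) ->
  usco (fun x => \bigcap_(i in D) g i x).
Proof.
move=> hY D0 gD dirD; apply: usco_bigcap => // x.
have FF : ProperFilter (filter_from D (g^~ x)).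
  apply: filter_from_proper; last by move=> i /gD[].
  apply: filter_from_filter => // i j Di Dj.
  have [k [Dk ki kj]] := dirD _ _ Di Dj.
  by exists k => // y gy; split; [exact: ki|exact: kj].
have [i0 Di0] := D0; have [_ /(_ x) cg _] := gD _ Di0.
have [|y [_ cy]] := cg (filter_from D (g^~ x)) _; first by exists i0.
exists y => i Di; have [_ /(_ x) ci _] := gD _ Di.
apply: (compact_closed hY ci) => B yB.
by apply: cy => //; exists i.
Qed.

Lemma uscoU g h : usco g -> usco h -> usco (fun x => g x `|` h x).
Proof.
move=> [g0 cg og] [h0 ch oh]; split.
- by move=> x; have [y gy] := g0 x; exists y; left.
- by move=> x; exact: compactU.
- move=> U oU; have := openI (og U oU) (oh U oU); congr open.
  by apply/seteqP; split => x /=; rewrite subUset.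
Qed.

Lemma uscoI g h : hausdorff_space Y -> usco g -> usco h ->
  (forall x, (g x `&` h x) !=set0) -> usco (fun x => g x `&` h x).
Proof.
move=> hY ug uh ne.
have -> : (fun x => g x `&` h x) =
          (fun x => \bigcap_(b in [set: bool]) (if b then g else h) x).
  apply/funext => x; apply/seteqP; split => y /=.
    by move=> [gy hy] [].
  by move=> gh; split; [exact: (gh true)|exact: (gh false)].
apply: usco_bigcap => //; first by exists true.
  by case.
move=> x; have [y [gy hy]] := ne x.
by exists y => -[].
Qed.

Lemma minusco_sub_usco g : hausdorff_space Y -> usco g ->
  exists f : minusco X Y, map_sub f g.
Proof.
move=> hY ug; pose T := {h : X -> set Y | usco h /\ map_sub h g}.
(* The order is reversed inclusion, so that a maximal element for [R] is a minimal usco map. *)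
pose R (a b : T) := `[< map_sub (sval b) (sval a) >].
pose t0 : T := exist _ g (conj ug (fun=> @subset_refl _ _)).
have [|||[h [uh hg]] hmax] := @ZL_preorder T t0 R.
- by move=> a; apply/asboolP => x.
- move=> b a c /asboolP ba /asboolP ac; apply/asboolP => x.
  exact: subset_trans (ac x) (ba x).
- move=> A totA; have [[a0 Aa0]|A0] := pselect (A !=set0); last first.
    (* The empty chain needs its own bound, since its intersection would be all of [Y]. *)
    exists t0 => a Aa.
    by case: A0; exists a.
  pose k x := \bigcap_(a in A) sval a x.
  have uk : usco k.
    apply: usco_bigcap_filtered => //; first by exists a0.
      by move=> [a []].
    move=> a b Aa Ab; have [/asboolP ab|/asboolP ba] := totA _ _ Aa Ab.
      by exists b; split => // x.
    by exists a; split => // x.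
  have kg : map_sub k g.
    by move=> x y /(_ _ Aa0); exact: (proj2 (svalP a0)).
  exists (exist _ k (conj uk kg)) => a Aa; apply/asboolP => x y /=.
  by apply.
- have mh : minimal_usco h.
    split => // h' uh' h'h; apply/funext => x; apply/seteqP.
    split; first exact: h'h.
    have h'g : map_sub h' g by move=> z; apply: subset_trans (h'h z) (hg z).
    have := hmax (exist _ h' (conj uh' h'g)); rewrite /R /=.
    by move=> /(_ (introT (asboolP _) h'h))/asboolP; exact.
  by exists (Minusco mh).
Qed.

End UscoTheory.

(** * The criterion for nets *)

Section NetConvergence.
Context {X Y : topologicalType} {d : Order.disp_t} {I : preorderType d}.
Variables (f : minusco X Y) (u : I -> minusco X Y).
Hypotheses (hY : hausdorff_space Y) (dirI : directed I).

Lemma tail_filter_minusco_in (g : X -> set Y) :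
  tail_filter u (minusco_in g) <->
  exists i, forall j, (i <= j)%O -> map_sub (u j) g.
Proof.
split=> [[i _ ig]|[i ig]].
  by exists i => j ij; apply: (ig (u j)); exists j.
by exists i => // _ [j ij <-]; exact: ig.
Qed.

Lemma converges_to_usco_net : converges_to (tail_filter u) f ->
  exists (i0 : I) (g : I -> X -> set Y),
    (forall i : I, (i0 <= i)%O -> usco (g i)) /\
    (forall i : I, (i0 <= i)%O -> map_sub (u i) (g i)) /\
    (forall i j : I, (i0 <= j)%O -> (j <= i)%O -> map_sub (g i) (g j)) /\
    unique_minusco_in f
      (fun x => \bigcap_(i in [set i | (i0 <= i)%O]) g i x).
Proof.
move=> [[g0 ug0 /tail_filter_minusco_in[i0 ui0]] fE].
pose D i := [set g : X -> set Y | usco g /\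
  forall j, (i <= j)%O -> map_sub (u j) g].
pose G i x := \bigcap_(g in D i) g x.
have uG i : map_sub (u i) (G i).
  by move=> x y uy g [_ /(_ i (Order.PreorderTheory.lexx i))]; exact.
exists i0, G; split; [|split; [|split; [|split]]].
- move=> i i0i; apply: usco_bigcap => //.
  (* Starting at [i0] ensures that [D i] contains [g0], so the intersection is not over an empty
     family. *)
  + exists g0; split => // j ij; apply: ui0.
    exact: Order.PreorderTheory.le_trans i0i ij.
  + by move=> g [].
  + move=> x; have [[/(_ x)[y uy] _ _] _] := minuscoP (u i).
    by exists y; exact: uG.
- by move=> i _.
- move=> i j _ ji x y Gy g [ug jg]; apply: Gy; split => // k ik.
  by apply: jg; exact: Order.PreorderTheory.le_trans ji ik.
- move=> x y fy i _ g [ug ig].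
  have : [set f] f by [].
  rewrite fE => /(_ g); apply => //; split => //.
  by apply/tail_filter_minusco_in; exists i.
- move=> h hG; suff : [set f] h by [].
  rewrite fE => g [ug /tail_filter_minusco_in[i ig]] x y hy.
  (* A map [g] that contains a tail from [i] on also belongs to [D k] for any [k] above [i], so [k]
     can be taken above [i0] too. *)
  have [k [ik i0k]] := dirI.2 i i0.
  apply: (hG _ _ hy k i0k); split => // j kj; apply: ig.
  exact: Order.PreorderTheory.le_trans ik kj.
Qed.

Lemma usco_net_converges_to (i0 : I) (g : I -> X -> set Y) :
  (forall i : I, (i0 <= i)%O -> usco (g i)) ->
  (forall i : I, (i0 <= i)%O -> map_sub (u i) (g i)) ->
  (forall i j : I, (i0 <= j)%O -> (j <= i)%O -> map_sub (g i) (g j)) ->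
  unique_minusco_in f (fun x => \bigcap_(i in [set i | (i0 <= i)%O]) g i x) ->
  converges_to (tail_filter u) f.
Proof.
move=> ug sub_ug dec [fg f_uniq].
have gF i : (i0 <= i)%O -> tail_filter u (minusco_in (g i)).
  move=> i0i; apply/tail_filter_minusco_in; exists i => j ij x.
  apply: subset_trans (dec _ _ i0i ij x); apply: sub_ug.
  exact: Order.PreorderTheory.le_trans i0i ij.
have i0i0 := Order.PreorderTheory.lexx i0.
split; first by exists (g i0); [exact: ug|exact: gF].
apply/seteqP; split => [_ ->|h hF]; last first.
  apply: f_uniq => x y hy i i0i.
  by have := hF (g i); apply => //; split; [exact: ug|exact: gF].
move=> h [uh /tail_filter_minusco_in[i1 uhi1]].
(* Only above [i1] is [u i] known to lie in [h], which is what makes the values of [k i]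
   nonempty. *)
pose D := [set i | (i0 <= i)%O /\ (i1 <= i)%O].
pose k i x := g i x `&` h x.
have D0 : D !=set0.
  by have [i [i0i i1i]] := dirI.2 i0 i1; exists i.
have [f' f'k] : exists f' : minusco X Y,
    map_sub f' (fun x => \bigcap_(i in D) k i x).
  apply: minusco_sub_usco => //; apply: usco_bigcap_filtered => //.
  - move=> i [i0i i1i]; apply: uscoI => //; first exact: ug.
    move=> x; have [[/(_ x)[y uy] _ _] _] := minuscoP (u i).
    by exists y; split; [exact: (sub_ug _ i0i)|exact: (uhi1 _ i1i)].
  - move=> i j [i0i i1i] [i0j i1j]; have [l [il jl]] := dirI.2 i j.
    exists l; split.
    + by split; [exact: Order.PreorderTheory.le_trans i0i il|
                 exact: Order.PreorderTheory.le_trans i1i il].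
    + by move=> x y [gy hy]; split => //; exact: (dec l).
    + by move=> x y [gy hy]; split => //; exact: (dec l).
have <- : f' = f.
  (* Indices above [i0] but not above [i1] are reached by monotonicity: some [l] in [D] lies above
     [i], and [g l] is contained in [g i]. *)
  apply: f_uniq => x y f'y i i0i; have [l [il i1l]] := dirI.2 i i1.
  apply: (dec l i i0i il).
  have Dl : D l by split => //; exact: Order.PreorderTheory.le_trans i0i il.
  by have [] := f'k _ _ f'y l Dl.
have [i Di] := D0.
by move=> x y f'y; have [] := f'k _ _ f'y i Di.
Qed.

End NetConvergence.

(** * The criterion for sequences *)

Lemma directed_nat : directed nat.
Proof.
split; first by exists 0.
by move=> i j; exists (maxn i j); rewrite !leEnat leq_maxl leq_maxr.
Qed.

(* Downward induction on [n0]: a sequence of usco maps given from [n0 + 1] on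
   is extended to the index [n0] by the union of [u n0] and [g n0.+1]. *)
Lemma usco_seq_from_start (X Y : topologicalType) (f : minusco X Y)
    (u : nat -> minusco X Y) (n0 : nat) (g : nat -> X -> set Y) :
  (forall n, (n0 <= n)%N -> usco (g n)) ->
  (forall n, (n0 <= n)%N -> map_sub (u n) (g n)) ->
  (forall m n, (n0 <= n)%N -> (n <= m)%N -> map_sub (g m) (g n)) ->
  unique_minusco_in f (fun x => \bigcap_(n in [set n | (n0 <= n)%N]) g n x) ->
  exists g : nat -> X -> set Y,
    (forall n, usco (g n)) /\
    (forall n, map_sub (u n) (g n)) /\
    (forall m n, (n <= m)%N -> map_sub (g m) (g n)) /\
    unique_minusco_in f (fun x => \bigcap_n g n x).
Proof.
elim: n0 g => [|n0 IH] g ug sub_ug dec fg.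
  exists g; split; [|split; [|split]].
  - by move=> n; exact: ug.
  - by move=> n; exact: sub_ug.
  - by move=> m n; exact: dec.
  - by rewrite (_ : setT = [set n | (0 <= n)%N])//; apply/seteqP; split.
pose g' n := if (n0 < n)%N then g n else fun x => u n0 x `|` g n0.+1 x.
apply: (IH g').
- move=> n _; rewrite /g'; case: ltnP => [|_]; first exact: ug.
  by apply: uscoU; [exact: (minuscoP (u n0)).1|exact: ug].
- move=> n n0n; rewrite /g'; case: ltnP => [|nn0]; first exact: sub_ug.
  have -> : n = n0 by apply/eqP; rewrite eqn_leq nn0.
  by move=> x y uy; left.
- move=> m n n0n nm; rewrite /g'; case: (ltnP n0 n) => [n0n'|nn0].
    by rewrite (leq_trans n0n' nm); exact: dec.
  by case: ltnP => [n0m|_] x y gy //; right; exact: dec gy.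
(* The new term at [n0] contains [g n0.+1], so it leaves the intersection unchanged. *)
- rewrite (_ : (fun x => _) =
    fun x => \bigcap_(n in [set n | (n0.+1 <= n)%N]) g n x) //.
  apply/funext => x; apply/seteqP; split => y gy n /= n0n.
    by have := gy n (ltnW n0n); rewrite /g' n0n.
  by rewrite /g'; case: ltnP => [|_]; [exact: gy|right; apply: gy => /=].
Qed.

Theorem theorem13 (X Y : topologicalType) (hY : hausdorff_space Y)
    (f : minusco X Y) :
  (forall (d : Order.disp_t) (I : preorderType d) (u : I -> minusco X Y),
    directed I ->
    (converges_to (tail_filter u) f <->
     exists (i0 : I) (g : I -> X -> set Y),
       (forall i : I, (i0 <= i)%O -> usco (g i)) /\
       (forall i : I, (i0 <= i)%O -> map_sub (u i) (g i)) /\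
       (forall i j : I, (i0 <= j)%O -> (j <= i)%O -> map_sub (g i) (g j)) /\
       unique_minusco_in f
         (fun x => \bigcap_(i in [set i | (i0 <= i)%O]) g i x)))
  /\
  (forall u : nat -> minusco X Y,
    converges_to (tail_filter u) f <->
    exists g : nat -> X -> set Y,
      (forall n, usco (g n)) /\
      (forall n, map_sub (u n) (g n)) /\
      (forall m n, (n <= m)%N -> map_sub (g m) (g n)) /\
      unique_minusco_in f (fun x => \bigcap_n g n x)).
Proof.
split=> [d I u dirI|u]; split.
- exact: converges_to_usco_net.
- move=> [i0 [g [ug [sub_ug [dec fg]]]]].
  exact: (usco_net_converges_to hY dirI ug sub_ug dec fg).
- move=> /(converges_to_usco_net hY directed_nat).
  move=> [n0 [g [ug [sub_ug [dec fg]]]]].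
  exact: (usco_seq_from_start ug sub_ug dec fg).
- move=> [g [ug [sub_ug [dec fg]]]].
  apply: (@usco_net_converges_to _ _ _ _ _ _ hY directed_nat 0 g) => //.
  + by move=> i j _ ji; exact: dec.
  + by rewrite (_ : [set i | _] = setT)//; apply/seteqP; split.
Qed.
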